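(* Let $E$ be a real normed vector space, let $\Omega$ be a nonempty open subset of $E$, let $m$ be a nonnegative integer, and let $f_i:\Omega\to\mathbb{R}$, $i\in\{0,\dots,m\}$, be functions. Let $\hat{x}$ be a solution of the problem $$(\mathcal{I})\qquad \text{maximize } f_0(x)\ \text{ subject to } x\in\Omega \text{ and } f_i(x)\ge 0 \text{ for all } i\in\{1,\dots,m\}.$$ Assume that: (i) for all $i\in\{0,\dots,m\}$, $f_i$ is Gâteaux differentiable at $\hat{x}$; (ii) for all $i\in\{1,\dots,m\}$ with $f_i(\hat{x})>0$, $f_i$ is lower semicontinuous at $\hat{x}$. Then there exist $\lambda_0,\dots,\lambda_m\in\mathbb{R}_+$ satisfying the following conditions: (a) $(\lambda_0,\dots,\lambda_m)\neq(0,\dots,0)$; (b) $\lambda_i f_i(\hat{x})=0$ for all $i\in\{1,\dots,m\}$; (c) $\sum_{i=0}^{m}\lambda_i D_Gf_i(\hat{x})=0$. If, in addition, (iii) there exists $w\in E$ such that $D_Gf_i(\hat{x})w>0$ for all $i\in\{1,\dots,m\}$ with $f_i(\hat{x})=0$, then $\lambda_0,\dots,\lambda_m\in\mathbb{R}_+$ satisfying (a), (b), (c) can be chosen so that (d) $\lambda_0=1$.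
   Context: $\mathbb{R}_+$ denotes the set of nonnegative real numbers. A solution of $(\mathcal{I})$ is a point $\hat{x}\in\Omega$ satisfying all the constraints and such that $f_0(x)\le f_0(\hat{x})$ for every $x\in\Omega$ satisfying all the constraints. Gâteaux differentiability: for normed vector spaces $E,F$, an open set $\Omega\subset E$, a mapping $f:\Omega\to F$ and $x\in\Omega$, $f$ is called Gâteaux differentiable at $x$ when there exists a bounded linear mapping $D_Gf(x)\in\mathcal{L}(E,F)$ such that for all $h\in E$, $\lim_{t\downarrow 0}\frac{f(x+th)-f(x)}{t}=D_Gf(x)h$. Here $\mathcal{L}(E,F)$ is the space of bounded linear mappings from $E$ into $F$. *)

(* Defs.v *)
From HB Require Import structures.
From mathcomp Require Import all_boot all_order all_algebra.
From mathcomp Require Import all_classical all_reals all_analysis.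

Set Implicit Arguments.
Unset Strict Implicit.
Unset Printing Implicit Defensive.

Import Order.TTheory GRing.Theory Num.Theory.
Import numFieldNormedType.Exports.

Local Open Scope classical_set_scope.
Local Open Scope ring_scope.

(* A mapping on an open set Omega is represented by a total function on the
   whole space. The notions below at a point x of Omega depend only on the
   values on a neighbourhood of x, and [maximizer] only on those on Omega, so
   the values outside Omega are irrelevant. *)

(* [bounded_near L (nbhs 0)] is equivalent to boundedness of the linear map L,
   see [linear_boundedP]. *)
Definition is_gateaux (R : realType) (E F : normedModType R) (f : E -> F)
    (x : E) (L : {linear E -> F}) : Prop :=
  bounded_near L (nbhs (0 : E)) /\
  forall h : E, t^-1 *: (f (x + t *: h) - f x) @[t --> (0 : R)^'+] --> L h.

Definition gateaux_differentiable (R : realType) (E F : normedModType R)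
    (f : E -> F) (x : E) : Prop :=
  exists L : {linear E -> F}, is_gateaux f x L.

(* Meaningful only when f is Gateaux differentiable at x, in which case the
   chosen L is unique, by uniqueness of limits. *)
Definition gateaux (R : realType) (E F : normedModType R) (f : E -> F)
    (x : E) : {linear E -> F} :=
  get (is_gateaux f x).

(* The library's [lower_semicontinuous] is global and for extended real-valued
   functions; this is its pointwise version. *)
Definition lower_semicontinuous_at (R : realType) (X : topologicalType)
    (f : X -> R) (x : X) : Prop :=
  forall a : R, a < f x -> \forall y \near x, a < f y.

(* The objective is f 0 and the constraints are f 1, ..., f m. *)
Definition feasible (R : realType) (E : normedModType R) (Omega : set E)
    (m : nat) (f : 'I_m.+1 -> E -> R^o) : set E :=
  [set x | Omega x /\ forall i : 'I_m.+1, (0 < i)%N -> 0 <= f i x].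

Definition maximizer (R : realType) (E : normedModType R) (Omega : set E)
    (m : nat) (f : 'I_m.+1 -> E -> R^o) (xhat : E) : Prop :=
  feasible Omega f xhat /\
  forall x : E, feasible Omega f x -> f ord0 x <= f ord0 xhat.

Definition multipliers (R : realType) (E : normedModType R) (m : nat)
    (f : 'I_m.+1 -> E -> R^o) (xhat : E) (lam : 'I_m.+1 -> R) : Prop :=
  [/\ forall i : 'I_m.+1, 0 <= lam i,
      exists i : 'I_m.+1, lam i != 0,
      forall i : 'I_m.+1, (0 < i)%N -> lam i * f i xhat = 0
    & forall h : E, \sum_(i < m.+1) lam i * gateaux (f i) xhat h = 0].

(* Main.v *)
Require Import Defs.
From HB Require Import structures.
From mathcomp Require Import all_boot all_order all_algebra.
From mathcomp Require Import all_classical all_reals all_analysis.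
From mathcomp Require Import ring lra.

Set Implicit Arguments.
Unset Strict Implicit.
Unset Printing Implicit Defensive.

Import Order.TTheory GRing.Theory Num.Theory.
Import numFieldNormedType.Exports.

Local Open Scope classical_set_scope.
Local Open Scope ring_scope.

(** The active forms [D_G f_i (xhat)] (those with [i = 0] or [f_i xhat = 0])
    have no common direction [h] of strict positivity: along such a direction
    every active [f_i] would strictly increase, while the inactive constraints
    stay positive by lower semicontinuity, so [xhat] would not be optimal.
    Gordan's alternative then yields the multipliers. If moreover [w] is as in
    (iii), [lambda_0 = 0] is impossible, as evaluating (c) at [w] would give a
    positive sum equal to zero; so one may divide by [lambda_0]. *)

(** Every term is nonnegative and one is positive. Asking for [0 < a i] only on the support of [lam]
    lets it be applied to multipliers carried by a subset of the indices. *)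
Lemma sum_mul_gt0 (R : realFieldType) (I : finType) (lam a : I -> R) :
  (forall i, 0 <= lam i) -> (exists i, lam i != 0) ->
  (forall i, lam i != 0 -> 0 < a i) -> 0 < \sum_i lam i * a i.
Proof.
move=> lam0 [i lami] apos.
have ge0 j : 0 <= lam j * a j.
  have [->|lamj] := eqVneq (lam j) 0; first by rewrite mul0r.
  by rewrite mulr_ge0// ltW// apos.
rewrite (bigD1 i)//= ltr_pwDl ?sumr_ge0//.
by rewrite mulr_gt0 ?apos// lt_def lami lam0.
Qed.

(* If [L a u = 1], the induction is applied both to the forms [L i] and to
   their compositions with the projection [h |-> h - L a h *: u] onto the
   kernel of [L a]. *)
Lemma gordan (R : realFieldType) (E : lmodType R) (I : finType) (s : seq I)
    (L : I -> E -> R) :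
  (forall i c u v, L i (c *: u + v) = c * L i u + L i v) ->
  (exists h, forall i, i \in s -> 0 < L i h) \/
  (exists lam : I -> R, [/\ forall i, 0 <= lam i, exists i, lam i != 0,
    forall i, lam i != 0 -> i \in s & forall h, \sum_i lam i * L i h = 0]).
Proof.
elim: s L => [|a s IH] L Llin; first by left; exists 0.
have [[h0 h0P]|[lam [lam0 lamN0 lams lamL]]] := IH L Llin; last first.
  by right; exists lam; split=> // i /lams; rewrite inE orbC => ->.
(* A zero form is annihilated by the indicator of [a]; otherwise it can be normalised to take the
   value 1. *)
have [La0|/existsNP[u0 /eqP Lau0]] := pselect (forall h, L a h = 0).
  right; exists (fun i => (i == a)%:R); split=> [i||i|h].
  - exact: ler0n.
  - by exists a; rewrite eqxx oner_neq0.
  - by case: (eqVneq i a) => [->|_]; rewrite ?mem_head ?eqxx.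
  - rewrite (bigD1 a)//= La0 mulr0 add0r big1// => i /negPf/= ->.
    by rewrite mul0r.
have L0 i : L i 0 = 0.
  by have := Llin i (-1) 0 0; rewrite scaler0 addr0 mulN1r addNr.
have LZ i c v : L i (c *: v) = c * L i v.
  by have := Llin i c v 0; rewrite !addr0 L0 addr0.
have LD i v w : L i (v + w) = L i v + L i w.
  by have := Llin i 1 v w; rewrite scale1r mul1r.
pose u := (L a u0)^-1 *: u0.
have Lau : L a u = 1 by rewrite /u LZ mulVf.
pose M i h := L i (h - L a h *: u).
have ME i h : M i h = L i h - L a h * L i u.
  by rewrite /M LD -scaleNr LZ mulNr.
have Mlin i c v w : M i (c *: v + w) = c * M i v + M i w.
  by rewrite !ME !LD !LZ; ring.
have [[h hP]|[lam [lam0 lamN0 lams lamM]]] := IH M Mlin.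
  left; pose v := h - L a h *: u.
  have Lav : L a v = 0 by rewrite -/(M a h) ME Lau mulr1 subrr.
  (* [v] is positive for the forms in [s] but lies in the kernel of [L a]. A small step along [u]
     raises [L a] to [e] and keeps the finitely many strict inequalities. *)
  have [e e0 eP] : exists2 e : R, 0 < e &
      forall i, i \in s -> 0 < L i v + e * L i u.
    have {}hP i : i \in s -> 0 < L i v by exact: hP.
    elim: (s) hP => [_|b r IHr bP]; first by exists 1.
    have [|e e0 eP] := IHr; first by move=> i ir; apply: bP; rewrite inE ir orbT.
    have bv : 0 < L b v by apply: bP; rewrite mem_head.
    (* The second bound gives [d + d * |L b u| <= L b v], so the step cannot cancel [L b v]; the
       added 1 makes the quotient defined and the inequality strict. *)
    pose d := Num.min e (L b v / (1 + `|L b u|)).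
    have n0 : 0 < 1 + `|L b u| by rewrite ltr_pwDl.
    have d0 : 0 < d by rewrite lt_min e0 divr_gt0.
    exists d => // i; rewrite inE => /predU1P[->|ir].
      have : d <= L b v / (1 + `|L b u|) by rewrite ge_min lexx orbT.
      rewrite ler_pdivlMr// => dle.
      have : d * - `|L b u| <= d * L b u by rewrite ler_pM2l// lerNnormlW.
      lra.
    have iv : 0 < L i v by apply: bP; rewrite inE ir orbT.
    have de : d <= e by rewrite ge_min lexx.
    have ieP := eP _ ir.
    (* Shrinking [e] to [d] is harmless: a step with [L i u >= 0] loses nothing, and if [L i u < 0]
       a shorter step loses less. *)
    have [u0i|u0i] := leP 0 (L i u).
      by rewrite ltr_pwDl// mulr_ge0// ltW.
    apply: lt_le_trans ieP _; rewrite lerD2l.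
    by rewrite ler_nM2r.
  exists (v + e *: u) => i; rewrite inE LD LZ => /predU1P[->|]; last exact: eP.
  by rewrite Lav Lau mulr1 add0r.
have [h0a|h0a] := ltP 0 (L a h0).
  by left; exists h0 => i; rewrite inE => /predU1P[->//|]; exact: h0P.
(* As [lam] annihilates the [M i], the combination of the [L i] is [c] times [L a]. At [h0] it is
   positive while [L a h0 <= 0], so [c < 0] and the weight [- c] on [a] is admissible. *)
right; pose c := \sum_i lam i * L i u.
have lamL h : \sum_i lam i * L i h = L a h * c.
  apply/eqP; rewrite -subr_eq0 -[X in _ == X](lamM h) /c mulr_sumr -sumrB.
  by apply/eqP/eq_bigr => i _; rewrite ME; ring.
have : 0 < L a h0 * c.
  by rewrite -lamL; apply: sum_mul_gt0 => // i /lams; exact: h0P.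
have [c0|c0] := leP 0 c; first by rewrite ltNge mulr_le0_ge0.
move=> _.
exists (fun i => lam i + (i == a)%:R * - c); split=> [i||i|h].
- by rewrite addr_ge0// mulr_ge0 ?ler0n// oppr_ge0 ltW.
- exists a; rewrite eqxx mul1r gt_eqF// ltr_wpDl// oppr_gt0//.
- rewrite inE; case: (eqVneq i a) => //= _; rewrite mul0r addr0; exact: lams.
- under eq_bigr do rewrite mulrDl.
  rewrite big_split/= lamL (bigD1 a)//= eqxx big1 => [|i /negPf/= ->].
    by rewrite mul1r; ring.
  by rewrite !mul0r.
Qed.

Lemma is_gateaux_gateaux (R : realType) (E F : normedModType R) (f : E -> F)
    (x : E) :
  gateaux_differentiable f x -> is_gateaux f x (gateaux f x).
Proof. exact: getPex. Qed.

(** Carries openness of [Omega] and lower semicontinuity at [x] over to small steps [t > 0] along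
    [h]. *)
Lemma cvg_ray (R : realType) (E : normedModType R) (x h : E) :
  x + t *: h @[t --> (0 : R)^'+] --> x.
Proof.
apply: cvg_at_right_filter.
rewrite -[X in _ --> X]addr0 -[X in _ --> _ + X](scale0r h).
by apply: cvgD; [exact: cvg_cst|apply: cvgZr_tmp; exact: cvg_id].
Qed.

Lemma gateaux_gt0_increases (R : realType) (E : normedModType R) (f : E -> R^o)
    (x h : E) : gateaux_differentiable f x -> 0 < gateaux f x h ->
  \forall t \near (0 : R)^'+, f x < f (x + t *: h).
Proof.
move=> /is_gateaux_gateaux[_ /(_ h) fh] h0.
near=> t.
have t0 : 0 < t by near: t; exact: nbhs_right_gt.
have : 0 < t^-1 *: (f (x + t *: h) - f x).
  by near: t; exact: cvgr_gt fh _ h0.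
by rewrite /GRing.scale/= pmulr_rgt0 ?invr_gt0// subr_gt0.
Unshelve. all: by end_near. Qed.

Lemma maximizer_no_ascent (R : realType) (E : normedModType R) (Omega : set E)
    (m : nat) (f : 'I_m.+1 -> E -> R^o) (xhat h : E) :
  open Omega -> maximizer Omega f xhat ->
  (forall i, gateaux_differentiable (f i) xhat) ->
  (forall i : 'I_m.+1, (0 < i)%N -> 0 < f i xhat ->
    lower_semicontinuous_at (f i) xhat) ->
  ~ (forall i : 'I_m.+1, i = ord0 \/ f i xhat = 0 ->
      0 < gateaux (f i) xhat h).
Proof.
move=> Oopen [[Ox fx0] fmax] fdiff flsc hP.
have nearO : \forall t \near (0 : R)^'+, Omega (xhat + t *: h).
  by apply: (@cvg_ray _ _ xhat h); exact: open_nbhs_nbhs.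
have near0 : \forall t \near (0 : R)^'+, f ord0 xhat < f ord0 (xhat + t *: h).
  by apply: gateaux_gt0_increases => //; apply: hP; left.
have nearf : \forall t \near (0 : R)^'+,
    forall i : 'I_m.+1, (0 < i)%N -> 0 <= f i (xhat + t *: h).
  (* There are finitely many constraints, so each may have its own range of [t]. *)
  apply: filter_forall => i.
  have [i0|i0] := posnP i; first by apply: nearW => t.
  have [fi0|fi0] := eqVneq (f i xhat) 0.
    have := gateaux_gt0_increases (fdiff i) (hP i (or_intror fi0)).
    by apply: filterS => t; rewrite fi0 => /ltW.
  have fi_gt0 : 0 < f i xhat by rewrite lt_def fi0 fx0.
  have : \forall t \near (0 : R)^'+, 0 < f i (xhat + t *: h).
    exact: (@cvg_ray _ _ xhat h) (flsc i i0 fi_gt0 0 fi_gt0).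
  by apply: filterS => t /ltW.
have [t [[Ot ft] f0t]] := filter_ex (filterI (filterI nearO nearf) near0).
by have := fmax _ (conj Ot ft); rewrite leNgt f0t.
Qed.

Theorem theorem2p1 (R : realType) (E : normedModType R) (Omega : set E)
    (Omega_neq0 : Omega !=set0) (Omega_open : open Omega)
    (m : nat) (f : 'I_m.+1 -> E -> R^o) (xhat : E)
    (xhat_max : maximizer Omega f xhat)
    (f_diff : forall i : 'I_m.+1, gateaux_differentiable (f i) xhat)
    (f_lsc : forall i : 'I_m.+1, (0 < i)%N -> 0 < f i xhat ->
      lower_semicontinuous_at (f i) xhat) :
  (exists lam : 'I_m.+1 -> R, multipliers f xhat lam) /\
  ((exists w : E, forall i : 'I_m.+1, (0 < i)%N -> f i xhat = 0 ->
      0 < gateaux (f i) xhat w) ->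
   exists lam : 'I_m.+1 -> R, multipliers f xhat lam /\ lam ord0 = 1).
Proof.
(* The objective counts as active whatever its value at [xhat]; multipliers supported on [active]
   satisfy (b). *)
pose active (i : 'I_m.+1) := (i == ord0) || (f i xhat == 0).
have [|[h hP]|[lam [lam0 lamN0 lams lamL]]] :=
    @gordan R E _ (enum active) (fun i => gateaux (f i) xhat).
- by move=> i c u v /=; rewrite linearP.
- exfalso; apply: (maximizer_no_ascent (h := h) Omega_open xhat_max) => // i ai.
  by apply: hP; rewrite mem_enum; apply/orP; case: ai => ->; rewrite eqxx; auto.
have {}lams i : lam i != 0 -> (0 < i)%N -> f i xhat = 0.
  move=> /lams; rewrite mem_enum => /orP[/eqP->//|/eqP//].
have lamM : multipliers f xhat lam.
  split=> // i i0; have [->|lami] := eqVneq (lam i) 0; first by rewrite mul0r.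
  by rewrite lams// mulr0.
split; first by exists lam.
move=> [w wP].
have lam00 : lam ord0 != 0.
  apply/eqP => lam00.
  suff : 0 < \sum_i lam i * gateaux (f i) xhat w by rewrite lamL ltxx.
  apply: sum_mul_gt0 => // i lami.
  have i0 : (0 < i)%N.
    rewrite lt0n; apply: contraNneq lami => i0.
    by rewrite (_ : i = ord0) ?lam00//; exact: val_inj.
  by apply: wP => //; exact: lams.
exists (fun i => (lam ord0)^-1 * lam i); split; last by rewrite mulVf.
split=> [i||i i0|h].
- by rewrite mulr_ge0// invr_ge0.
- by exists ord0; rewrite mulVf// oner_neq0.
- by case: lamM => _ _ fl _; rewrite -mulrA fl// mulr0.
- under eq_bigr do rewrite -mulrA.
  by rewrite -mulr_sumr lamL mulr0.
Qed.
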